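(* Let $\bar x\in\{0,1\}^n$, $\bar y\in\{0,1\}^m$, $\bar z\in\{0,1\}^l$ and define $\bar{\mathcal W}=(\bar w_{ijk}):=\bar x\otimes\bar y\otimes\bar z$. Let $\mathcal G\in\{0,1\}^{n\times m\times l}$ be such that $\mathcal F\ne\emptyset$, and let $\alpha<1$ be a constant arbitrarily close to $1$. Suppose that: (0) For each $i\in[n]$ with $\bar x_i=0$ we have $F^{x,i}>0$; for each $j\in[m]$ with $\bar y_j=0$ we have $F^{y,j}>0$; for each $k\in[l]$ with $\bar z_k=0$ we have $F^{z,k}>0$. (1) For each $i\in[n],j\in[m]$ with $\bar x_i=\bar y_j=1$ we have $T^{x,y,i,j}_1\ge1$; for each $j\in[m],k\in[l]$ with $\bar y_j=\bar z_k=1$ we have $T^{y,z,j,k}_1\ge1$; for each $i\in[n],k\in[l]$ with $\bar x_i=\bar z_k=1$ we have $T^{x,z,i,k}_1\ge1$. (2) For each $i\in[n]$ with $\bar x_i=0$, $T^{x,i}_{111}\ge\alpha T^{x,i}_{11}\bar T^{y,z}_1$; for each $j\in[m]$ with $\bar y_j=0$, $T^{y,j}_{111}\ge\alpha T^{y,j}_{11}\bar T^{x,z}_1$; for each $k\in[l]$ with $\bar z_k=0$, $T^{z,k}_{111}\ge\alpha T^{z,k}_{11}\bar T^{x,y}_1$. (3) For each $(i,j,k)\in\mathcal T$ with $\bar x_i=0$, $\bar y_j=\bar z_k=1$, $$\min\left\{T^{x,i}_{11},\ \frac{T^{x,i}_{111}}{T^{y,z,j,k}_1}\right\}>B^{x,i};$$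 for each $(i,j,k)\in\mathcal T$ with $\bar y_j=0$, $\bar x_i=\bar z_k=1$, $$\min\left\{T^{y,j}_{11},\ \frac{T^{y,j}_{111}}{T^{x,z,i,k}_1}\right\}>B^{y,j};$$ for each $(i,j,k)\in\mathcal T$ with $\bar z_k=0$, $\bar x_i=\bar y_j=1$, $$\min\left\{T^{z,k}_{11},\ \frac{T^{z,k}_{111}}{T^{x,y,i,j}_1}\right\}>B^{z,k}.$$ (4) For each $(i,j,k)\in\mathcal T\cap\mathcal P$, $$3\bar\gamma_{ijk}>\max\left\{\frac{F^{x,i}_{11}}{T^{x,i}_{11}},\frac{F^{y,j}_{11}}{T^{y,j}_{11}},\frac{F^{z,k}_{11}}{T^{z,k}_{11}}\right\},$$ where $$\bar\gamma_{ijk}:=\frac13\Bigg(2-\frac13\frac{n_{\bar x}}{T^{y,z,j,k}_1}-\frac13\frac{n_{\bar y}}{T^{x,z,i,k}_1}-\frac13\frac{n_{\bar z}}{T^{x,y,i,j}_1}-\frac1{\alpha\bar T^{y,z}_1}\sum_{\substack{i':\bar x_{i'}=0\\(i',j,k)\in\mathcal T}}\frac{B^{x,i'}}{T^{x,i'}_{11}}-\frac1{\alpha\bar T^{x,z}_1}\sum_{\substack{j':\bar y_{j'}=0\\(i,j',k)\in\mathcal T}}\frac{B^{y,j'}}{T^{y,j'}_{11}}-\frac1{\alpha\bar T^{x,y}_1}\sum_{\substack{k':\bar z_{k'}=0\\(i,j,k')\in\mathcal T}}\frac{B^{z,k'}}{T^{z,k'}_{11}}\Bigg).$$ Then $(\bar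 x,\bar y,\bar z,\bar{\mathcal W})$ is the unique optimal solution of the flower LP (fLP).
   Context: Write $[n]=\{1,\dots,n\}$; $x\otimes y\otimes z$ is the tensor with $(i,j,k)$ entry $x_iy_jz_k$. $n_{\bar x},n_{\bar y},n_{\bar z}$ are the numbers of ones in $\bar x,\bar y,\bar z$. For $\mathcal G=(g_{ijk})$ put $S_0=\{(i,j,k):g_{ijk}=0\}$, $S_1=\{(i,j,k):g_{ijk}=1\}$, $\mathcal P=\{(i,j,k)\in[n]\times[m]\times[l]:\bar x_i=\bar y_j=\bar z_k=1\}$, $\mathcal T=\{(i,j,k):g_{ijk}=\bar x_i\bar y_j\bar z_k\}$, $\mathcal F=\{(i,j,k):g_{ijk}=1-\bar x_i\bar y_j\bar z_k\}$. For $r,s\in\{0,1\}$: $T^{x,i}_{rs}$ (resp. $F^{x,i}_{rs}$) is the number of $(j,k)\in[m]\times[l]$ with $\bar y_j=r$, $\bar z_k=s$ and $(i,j,k)\in\mathcal T$ (resp. $\in\mathcal F$); $T^{y,j}_{rs}$ (resp. $F^{y,j}_{rs}$) is the number of $(i,k)\in[n]\times[l]$ with $\bar x_i=r$, $\bar z_k=s$ and $(i,j,k)\in\mathcal T$ (resp. $\in\mathcal F$); $T^{z,k}_{rs}$ (resp. $F^{z,k}_{rs}$) is the number of $(i,j)\in[n]\times[m]$ with $\bar x_i=r$, $\bar y_j=s$ and $(i,j,k)\in\mathcal T$ (resp. $\in\mathcal F$). For $*\in\{(x,i),(y,j),(z,k)\}$ let $F^{*}=F^{*}_{00}+F^{*}_{10}+F^{*}_{01}+F^{*}_{11}$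 and, as shorthand, $B^{*}:=\tfrac13F^{*}_{00}+\tfrac12(F^{*}_{01}+F^{*}_{10})+F^{*}_{11}$. $T^{x,y,i,j}_1=|\{k\in[l]:\bar z_k=1,(i,j,k)\in\mathcal T\}|$, $T^{x,z,i,k}_1=|\{j\in[m]:\bar y_j=1,(i,j,k)\in\mathcal T\}|$, $T^{y,z,j,k}_1=|\{i\in[n]:\bar x_i=1,(i,j,k)\in\mathcal T\}|$. $T^{x,i}_{111}$ is the number of $(j,k,i')\in[m]\times[l]\times[n]$ with $\bar y_j=\bar z_k=\bar x_{i'}=1$, $(i,j,k)\in\mathcal T$, $(i',j,k)\in\mathcal T$; $T^{y,j}_{111}$ is the number of $(i,k,j')\in[n]\times[l]\times[m]$ with $\bar x_i=\bar z_k=\bar y_{j'}=1$, $(i,j,k)\in\mathcal T$, $(i,j',k)\in\mathcal T$; $T^{z,k}_{111}$ is the number of $(i,j,k')\in[n]\times[m]\times[l]$ with $\bar x_i=\bar y_j=\bar z_{k'}=1$, $(i,j,k)\in\mathcal T$, $(i,j,k')\in\mathcal T$. $\bar T^{x,y}_1=\frac1{nm}\sum_{i\in[n],j\in[m]}T^{x,y,i,j}_1$, $\bar T^{x,z}_1=\frac1{nl}\sum_{i\in[n],k\in[l]}T^{x,z,i,k}_1$, $\bar T^{y,z}_1=\frac1{ml}\sum_{j\in[m],k\in[l]}T^{y,z,j,k}_1$. The flower LP (fLP), in variables $x\in\mathbb R^n,y\in\mathbb R^m,z\in\mathbb R^l,\mathcal W=(w_{ijk})\in\mathbb R^{n\times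 m\times l}$, is: minimize $\sum_{(i,j,k)\in S_0}w_{ijk}+\sum_{(i,j,k)\in S_1}(1-w_{ijk})$ subject to $w_{ijk}\le x_i$, $w_{ijk}\le y_j$, $w_{ijk}\le z_k$ for all $(i,j,k)\in S_1$; $w_{ijk}\ge0$, $w_{ijk}\ge x_i+y_j+z_k-2$ for all $(i,j,k)\in S_0$; $w_{i'jk}-w_{ijk}\le1-x_i$ for all $(i,j,k)\in S_0,(i',j,k)\in S_1$; $w_{ij'k}-w_{ijk}\le1-y_j$ for all $(i,j,k)\in S_0,(i,j',k)\in S_1$; $w_{ijk'}-w_{ijk}\le1-z_k$ for all $(i,j,k)\in S_0,(i,j,k')\in S_1$; and $(x,y,z)\in[0,1]^{n+m+l}$.
   Formalization: Adds T^{x,i}_{11}≥1 whenever x̄_i=0 (likewise for y, z); without it (3) can be void and the claim fails, e.g. n=2, m=l=1, x̄=(1,0), ȳ=z̄=(1), G all ones. The condition is necessary for the conclusion. α is taken in (0,1). *)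

(* Defs.v *)
(* Library: Mathematical Components. *)
From mathcomp Require Export all_boot all_order all_algebra.
Set Implicit Arguments.
Unset Strict Implicit.
Unset Printing Implicit Defensive.
Import Order.TTheory GRing.Theory Num.Theory.

#[global] Open Scope ring_scope.

(* Indices are 0-based: 'I_n stands for {1, ..., n}.  A 0/1 vector or tensor
   is a boolean finite function; [realv] is its image in R. *)
Notation vec A n := {ffun 'I_n -> A}.
Notation index n m l := ('I_n * 'I_m * 'I_l)%type.
Notation tensor A n m l := {ffun index n m l -> A}.

Definition outer (R : realFieldType) n m l
    (x : vec R n) (y : vec R m) (z : vec R l) : tensor R n m l :=
  [ffun t => x t.1.1 * y t.1.2 * z t.2].

Definition realv (R : realFieldType) n (x : vec bool n) : vec R n :=
  [ffun i => (x i)%:R].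

Definition ones n (x : vec bool n) : nat := #|[set i | x i]|.

Section FlowerLP.
Variables (R : realFieldType) (n m l : nat) (G : tensor bool n m l).

Definition S0 : {set index n m l} := [set t | ~~ G t].
Definition S1 : {set index n m l} := [set t | G t].

Definition flp_point : Type := (vec R n * vec R m * vec R l * tensor R n m l)%type.

Definition flp_objective (p : flp_point) : R :=
  let: (x, y, z, w) := p in
  \sum_(t in S0) w t + \sum_(t in S1) (1 - w t).

Definition flp_feasible (p : flp_point) : Prop :=
  let: (x, y, z, w) := p in
  [/\ forall i j k, (i, j, k) \in S1 ->
        [/\ w (i, j, k) <= x i, w (i, j, k) <= y j & w (i, j, k) <= z k],
      forall i j k, (i, j, k) \in S0 ->
        0 <= w (i, j, k) /\ x i + y j + z k - 2 <= w (i, j, k),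
      [/\ forall i j k i', (i, j, k) \in S0 -> (i', j, k) \in S1 ->
            w (i', j, k) - w (i, j, k) <= 1 - x i,
          forall i j k j', (i, j, k) \in S0 -> (i, j', k) \in S1 ->
            w (i, j', k) - w (i, j, k) <= 1 - y j
        & forall i j k k', (i, j, k) \in S0 -> (i, j, k') \in S1 ->
            w (i, j, k') - w (i, j, k) <= 1 - z k]
    & [/\ forall i, 0 <= x i <= 1,
          forall j, 0 <= y j <= 1
        & forall k, 0 <= z k <= 1]].

Definition flp_optimal (p : flp_point) : Prop :=
  flp_feasible p /\
  forall q, flp_feasible q -> flp_objective p <= flp_objective q.

Definition flp_unique_optimal (p : flp_point) : Prop :=
  flp_optimal p /\ forall q, flp_optimal q -> q = p.

End FlowerLP.

Section Counts.
Variables (n m l : nat).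
Variables (xb : vec bool n) (yb : vec bool m) (zb : vec bool l).
Variable G : tensor bool n m l.

Definition Pset : {set index n m l} :=
  [set t | [&& xb t.1.1, yb t.1.2 & zb t.2]].
Definition Tset : {set index n m l} :=
  [set t | G t == [&& xb t.1.1, yb t.1.2 & zb t.2]].
Definition Fset : {set index n m l} :=
  [set t | G t == ~~ [&& xb t.1.1, yb t.1.2 & zb t.2]].

(* T^{x,i}_{rs}, F^{x,i}_{rs}, and similarly for y and z; the bits r, s are
   those of the two remaining vectors, in the order x, y, z. *)
Definition Tx (r s : bool) (i : 'I_n) : nat :=
  #|[set q : 'I_m * 'I_l |
      [&& yb q.1 == r, zb q.2 == s & (i, q.1, q.2) \in Tset]]|.
Definition Fx (r s : bool) (i : 'I_n) : nat :=
  #|[set q : 'I_m * 'I_l |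
      [&& yb q.1 == r, zb q.2 == s & (i, q.1, q.2) \in Fset]]|.
Definition Ty (r s : bool) (j : 'I_m) : nat :=
  #|[set q : 'I_n * 'I_l |
      [&& xb q.1 == r, zb q.2 == s & (q.1, j, q.2) \in Tset]]|.
Definition Fy (r s : bool) (j : 'I_m) : nat :=
  #|[set q : 'I_n * 'I_l |
      [&& xb q.1 == r, zb q.2 == s & (q.1, j, q.2) \in Fset]]|.
Definition Tz (r s : bool) (k : 'I_l) : nat :=
  #|[set q : 'I_n * 'I_m |
      [&& xb q.1 == r, yb q.2 == s & (q.1, q.2, k) \in Tset]]|.
Definition Fz (r s : bool) (k : 'I_l) : nat :=
  #|[set q : 'I_n * 'I_m |
      [&& xb q.1 == r, yb q.2 == s & (q.1, q.2, k) \in Fset]]|.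

Definition Fxtot (i : 'I_n) : nat :=
  (Fx false false i + Fx true false i + Fx false true i + Fx true true i)%N.
Definition Fytot (j : 'I_m) : nat :=
  (Fy false false j + Fy true false j + Fy false true j + Fy true true j)%N.
Definition Fztot (k : 'I_l) : nat :=
  (Fz false false k + Fz true false k + Fz false true k + Fz true true k)%N.

Definition T1xy (i : 'I_n) (j : 'I_m) : nat :=
  #|[set k | zb k && ((i, j, k) \in Tset)]|.
Definition T1xz (i : 'I_n) (k : 'I_l) : nat :=
  #|[set j | yb j && ((i, j, k) \in Tset)]|.
Definition T1yz (j : 'I_m) (k : 'I_l) : nat :=
  #|[set i | xb i && ((i, j, k) \in Tset)]|.

Definition T111x (i : 'I_n) : nat :=
  #|[set q : 'I_m * 'I_l * 'I_n | let: (j, k, i') := q in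
      [&& yb j, zb k, xb i', (i, j, k) \in Tset & (i', j, k) \in Tset]]|.
Definition T111y (j : 'I_m) : nat :=
  #|[set q : 'I_n * 'I_l * 'I_m | let: (i, k, j') := q in
      [&& xb i, zb k, yb j', (i, j, k) \in Tset & (i, j', k) \in Tset]]|.
Definition T111z (k : 'I_l) : nat :=
  #|[set q : 'I_n * 'I_m * 'I_l | let: (i, j, k') := q in
      [&& xb i, yb j, zb k', (i, j, k) \in Tset & (i, j, k') \in Tset]]|.

Variable R : realFieldType.

Definition Bx (i : 'I_n) : R :=
  1 / 3 * (Fx false false i)%:R
  + 1 / 2 * ((Fx false true i)%:R + (Fx true false i)%:R)
  + (Fx true true i)%:R.
Definition By (j : 'I_m) : R :=
  1 / 3 * (Fy false false j)%:R
  + 1 / 2 * ((Fy false true j)%:R + (Fy true false j)%:R)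
  + (Fy true true j)%:R.
Definition Bz (k : 'I_l) : R :=
  1 / 3 * (Fz false false k)%:R
  + 1 / 2 * ((Fz false true k)%:R + (Fz true false k)%:R)
  + (Fz true true k)%:R.

(* Averages over all pairs of indices, not only those in the supports. *)
Definition Tbarxy : R := (n * m)%:R^-1 * \sum_i \sum_j (T1xy i j)%:R.
Definition Tbarxz : R := (n * l)%:R^-1 * \sum_i \sum_k (T1xz i k)%:R.
Definition Tbaryz : R := (m * l)%:R^-1 * \sum_j \sum_k (T1yz j k)%:R.

Definition gamma (alpha : R) (i : 'I_n) (j : 'I_m) (k : 'I_l) : R :=
  1 / 3 *
  (2 - 1 / 3 * ((ones xb)%:R / (T1yz j k)%:R)
     - 1 / 3 * ((ones yb)%:R / (T1xz i k)%:R)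
     - 1 / 3 * ((ones zb)%:R / (T1xy i j)%:R)
     - 1 / (alpha * Tbaryz) *
         \sum_(i' | ~~ xb i' && ((i', j, k) \in Tset))
            Bx i' / (Tx true true i')%:R
     - 1 / (alpha * Tbarxz) *
         \sum_(j' | ~~ yb j' && ((i, j', k) \in Tset))
            By j' / (Ty true true j')%:R
     - 1 / (alpha * Tbarxy) *
         \sum_(k' | ~~ zb k' && ((i, j, k') \in Tset))
            Bz k' / (Tz true true k')%:R).

End Counts.

(* Main.v *)
Require Import Defs.
From mathcomp Require Import ring lra.
Set Implicit Arguments.
Unset Strict Implicit.
Unset Printing Implicit Defensive.
Import Order.TTheory GRing.Theory Num.Theory.

(** Write P for the support of the target tensor, T and F for the entries where
    G is right and wrong.  The target costs 1 on each entry of F, so for a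
    feasible point the excess of the objective over the target is
      sum of w over T minus P  +  sum of 1 - w over T and P
      - sum of 1 - w over F and P  -  sum of w over F minus P.
    The first two sums are gains, the last two are losses, and the theorem says
    that the losses are strictly outweighed.

    Losses on F minus P ([false_ones_bound]).  There G = 1, so w is at most each
    of x_i, y_j, z_k, hence at most the average of those that vanish at the
    target.  Collecting per index gives B^{x,i} x_i + B^{y,j} y_j + B^{z,k} z_k:
    this is where the weights 1/3, 1/2, 1 of B come from.  Such an x_i is paid
    for by the flower inequalities: if G is 0 at (i,j,k) and 1 at (i',j,k), both
    rightly, with i' in the support, then x_i <= w_ijk + (1 - w_i'jk).  Averaging
    over all T_111 such pairs bounds B x_i by gains ([zero_bound]); the part of
    w_ijk that is used is B T_1 / T_111, less than 1 by condition (3).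

    Losses on F and P ([one_bound]).  The flower inequalities now read
    1 - w_ijk <= (1 - x_i) + (1 - w_i'jk), with (i',j,k) in T and P; average them
    over the T_1 choices of i', and take one third of each of the three
    directions.  The terms 1 - x_i are in turn at most 1 - w on the T_11 entries
    of T and P in the slice of i.  This produces the terms n / T_1 and F_11 / T_11.

    What remains of 1 - w_ijk on T and P is the coefficient [core_slack]
    ([objective_gap]).  Condition (2) turns the denominators T_111 into alpha T_11
    times an average of T_1, and the coefficient is then at least 3 gamma minus
    one third of the sum of the three ratios F_11 / T_11, positive by
    condition (4).

    Hence the target is optimal, and an optimal point has w = 0 on the petals and
    w = 1 on T and P.  This pins x, y, z ([axis_pinned]), and once these are
    known all four sums above have a definite sign, which pins w
    ([tensor_pinned]). *)

(** * One direction of the tensor *)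

(** The three directions are treated at once: an entry t of the tensor has
    coordinates [c t = (i, q)], where [i] runs along the direction and [q] is the
    pair of the two other indices.  [a] is the target vector of the direction and
    [b] the product of the two other target vectors. *)
Section Axis.
Variables (R : realFieldType) (I Q S : finType) (c : S -> I * Q) (e : I * Q -> S).
Hypotheses (cK : cancel c e) (eK : cancel e c).
Variables (a : pred I) (b : pred Q) (G : pred S).

(** A petal is a rightly null entry that leaves the support in this direction
    only.  Each core entry of its line gives a flower inequality, said below to be
    centered at the index [i] of the petal.  The holes are the null entries
    inside the support. *)
Definition core (t : S) := [&& a (c t).1, b (c t).2 & G t].
Definition hole (t : S) := [&& a (c t).1, b (c t).2 & ~~ G t].
Definition petal (t : S) := [&& ~~ a (c t).1, b (c t).2 & ~~ G t].

(** On [b], these are the numbers T_1, T_11 and F_11; [flowers] is T_111, the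
    number of flower inequalities centered at [i], for [i] outside [a]. *)
Definition hits (q : Q) : nat := #|[set i | a i && G (e (i, q))]|.
Definition agree (i : I) : nat := #|[set q | b q && (G (e (i, q)) == a i)]|.
Definition clash (i : I) : nat := #|[set q | b q && (G (e (i, q)) != a i)]|.
Definition flowers (i : I) : nat := \sum_(q | b q && ~~ G (e (i, q))) hits q.

(** Total multiplier that a core entry on the line [q] receives when each of the
    flower inequalities centered at [i] has multiplier [beta i / flowers i]. *)
Definition load (beta : I -> R) (q : Q) : R :=
  \sum_(i | ~~ a i && ~~ G (e (i, q))) beta i / (flowers i)%:R.

Definition petal_slack (beta : I -> R) (t : S) : R :=
  1 - beta (c t).1 * (hits (c t).2)%:R / (flowers (c t).1)%:R.

(** Share of the holes borne by a core entry: each line has [#|a| - hits] holes,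
    split evenly among its [hits] core entries, and each slice [i] has [clash i]
    holes, split among its [agree i] core entries. *)
Definition charge (t : S) : R :=
  #|a|%:R / (hits (c t).2)%:R - 1 + (clash (c t).1)%:R / (agree (c t).1)%:R.

Lemma coreE i q : core (e (i, q)) = [&& a i, b q & G (e (i, q))].
Proof. by rewrite /core eK. Qed.

Lemma holeE i q : hole (e (i, q)) = [&& a i, b q & ~~ G (e (i, q))].
Proof. by rewrite /hole eK. Qed.

Lemma petalE i q : petal (e (i, q)) = [&& ~~ a i, b q & ~~ G (e (i, q))].
Proof. by rewrite /petal eK. Qed.

Let entryE := (coreE, holeE, petalE, eK).

Lemma sum_axis (P : pred S) (F : S -> R) :
  \sum_(t | P t) F t = \sum_i \sum_(q | P (e (i, q))) F (e (i, q)).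
Proof.
rewrite (reindex e) /=; last by apply: onW_bij; exists c.
by rewrite pair_big_dep /=; apply: eq_big => [[i q]|[i q] _].
Qed.

Lemma sum_axis_col (P : pred S) (F : S -> R) :
  \sum_(t | P t) F t = \sum_q \sum_(i | P (e (i, q))) F (e (i, q)).
Proof. by rewrite sum_axis (exchange_big_dep xpredT). Qed.

Variables (x : I -> R) (w : S -> R).
Hypothesis flower : forall i i' q, ~~ G (e (i, q)) -> G (e (i', q)) ->
  w (e (i', q)) - w (e (i, q)) <= 1 - x i.

Lemma sum_hits (q : Q) (r : R) :
  \sum_(i | a i && G (e (i, q))) r = (hits q)%:R * r.
Proof.
rewrite sumr_const mulr_natl; congr (_ *+ _).
by apply: eq_card => i; rewrite !inE.
Qed.

(** Average, with total weight [beta i], the flower inequalities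
    [x i <= w petal + (1 - w core)] centered at [i]; a petal on the line [q]
    occurs in [hits q] of them. *)
Lemma zero_bound (beta : I -> R) :
  (forall i, 0 <= beta i) -> (forall i, ~~ a i -> (0 < flowers i)%N) ->
  \sum_(i | ~~ a i) beta i * x i <=
    \sum_(t | petal t)
       (beta (c t).1 * (hits (c t).2)%:R / (flowers (c t).1)%:R) * w t
    + \sum_(t | core t) load beta (c t).2 * (1 - w t).
Proof.
move=> beta0 fl0.
have -> : \sum_(t | core t) load beta (c t).2 * (1 - w t)
  = \sum_(i | ~~ a i) \sum_(q | b q && ~~ G (e (i, q)))
     \sum_(i' | a i' && G (e (i', q)))
       beta i / (flowers i)%:R * (1 - w (e (i', q))).
  rewrite sum_axis_col [RHS](exchange_big_dep b) /=; last by move=> i q _ /andP[].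
  rewrite [RHS]big_mkcond; apply: eq_bigr => q _ /=.
  case: (boolP (b q)) => bq; last first.
    by rewrite big_pred0 // => i; rewrite !entryE /= (negPf bq) andbF.
  rewrite exchange_big /=; apply: eq_big => [i|i _]; first by rewrite !entryE bq.
  by rewrite !entryE /load mulr_suml.
have -> : \sum_(t | petal t)
       (beta (c t).1 * (hits (c t).2)%:R / (flowers (c t).1)%:R) * w t
  = \sum_(i | ~~ a i) \sum_(q | b q && ~~ G (e (i, q)))
     \sum_(i' | a i' && G (e (i', q))) beta i / (flowers i)%:R * w (e (i, q)).
  rewrite sum_axis [RHS]big_mkcond; apply: eq_bigr => i _ /=.
  case: (boolP (a i)) => ai /=.
    by rewrite big_pred0 // => q; rewrite !entryE /= ai.
  apply: eq_big => [q|q _]; first by rewrite !entryE /= ai.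
  by rewrite !entryE /= sum_hits; ring.
rewrite -big_split /=; apply: ler_sum => i ai.
have f0 : (flowers i)%:R != 0 :> R by rewrite pnatr_eq0 -lt0n fl0.
rewrite -big_split /=.
have -> : beta i * x i = \sum_(q | b q && ~~ G (e (i, q)))
     \sum_(i' | a i' && G (e (i', q))) beta i / (flowers i)%:R * x i.
  under eq_bigr do rewrite sum_hits.
  rewrite -mulr_suml -natr_sum -/(flowers i); field; exact: f0.
apply: ler_sum => q /andP[bq gq]; rewrite -big_split /=.
apply: ler_sum => i' /andP[ai' gi']; rewrite -mulrDr.
apply: ler_wpM2l; first by rewrite divr_ge0.
by have := flower gq gi'; lra.
Qed.

(** Call [1 - w t] the deficit at [t].  A flower inequality whose null entry is a
    hole says that the deficit of the hole is at most [1 - x i] plus the deficit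
    of a core entry of the same line.  Each term [1 - x i] is at most the
    deficit of every one of the core entries of the slice. *)
Lemma one_bound :
  (forall t, core t -> w t <= x (c t).1) ->
  (forall q, b q -> (0 < hits q)%N) -> (forall i, a i -> (0 < agree i)%N) ->
  \sum_(t | hole t) (1 - w t) <=
  \sum_(t | core t) charge t * (1 - w t).
Proof.
move=> wx h0 ag0.
have clashE i : a i -> clash i = #|[pred q | b q && ~~ G (e (i, q))]|.
  by move=> ai; apply: eq_card => q; rewrite !inE ai; case: (G _).
have agreeE i : a i -> agree i = #|[pred q | b q && G (e (i, q))]|.
  by move=> ai; apply: eq_card => q; rewrite !inE ai; case: (G _).
pose m q := (hits q)%:R^-1 * \sum_(i' | a i' && G (e (i', q))) (1 - w (e (i', q))).
apply: (@le_trans _ _ (\sum_(t | hole t)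
   ((1 - x (c t).1) + m (c t).2))).
  apply: ler_sum => t /and3P[at_ bt gt].
  have hq : 0 < (hits (c t).2)%:R :> R by rewrite ltr0n h0.
  rewrite -lerBlDl /m -ler_pdivrMl ?invr_gt0 // invrK.
  rewrite -sum_hits; apply: ler_sum => i' /andP[_ gi'].
  have := @flower (c t).1 i' (c t).2; rewrite -surjective_pairing cK.
  by move=> /(_ gt gi'); lra.
rewrite big_split /= /charge.
rewrite [leRHS](eq_bigr (fun t => (#|a|%:R / (hits (c t).2)%:R - 1) * (1 - w t)
   + (clash (c t).1)%:R / (agree (c t).1)%:R * (1 - w t))); last first.
  by move=> t _; rewrite mulrDl.
(* The mean deficits [m] are summed by lines, the terms [1 - x i] by slices. *)
rewrite [leRHS]big_split /= addrC; apply: lerD.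
  rewrite !sum_axis_col; apply: ler_sum => q _.
  case: (boolP (b q)) => bq; last first.
    by rewrite !big_pred0 // => i; rewrite !entryE /= (negPf bq) andbF.
  rewrite (eq_bigl (fun i => a i && ~~ G (e (i, q)))); last first.
    by move=> i; rewrite !entryE /= bq.
  rewrite [leRHS](eq_bigl (fun i => a i && G (e (i, q)))); last first.
    by move=> i; rewrite !entryE /= bq.
  rewrite (eq_bigr (fun _ => m q)); last by move=> i _; rewrite !entryE.
  rewrite [leRHS](eq_bigr (fun i =>
     (#|a|%:R / (hits q)%:R - 1) * (1 - w (e (i, q))))); last first.
    by move=> i _; rewrite !entryE.
  have hq : (hits q)%:R != 0 :> R by rewrite pnatr_eq0 -lt0n h0.
  suff E : (#|[pred i | a i && ~~ G (e (i, q))]|)%:R = #|a|%:R - (hits q)%:R :> R.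
    by rewrite sumr_const -mulr_sumr -[leLHS]mulr_natl E /m mulrA mulrBl mulfV.
  rewrite -(cardID [pred i | G (e (i, q))] a) natrD.
  have -> : #|[predI a & [pred i | G (e (i, q))]]| = hits q.
    by apply: eq_card => i; rewrite !inE.
  rewrite addrC addKr; congr (GRing.natmul _ _); apply: eq_card => i.
  by rewrite !inE andbC.
rewrite !sum_axis; apply: ler_sum => i _.
case: (boolP (a i)) => ai; last first.
  by rewrite !big_pred0 // => q; rewrite !entryE /= (negPf ai).
rewrite (eq_bigl (fun q => b q && ~~ G (e (i, q)))); last first.
  by move=> q; rewrite !entryE /= ai.
rewrite [leRHS](eq_bigl (fun q => b q && G (e (i, q)))); last first.
  by move=> q; rewrite !entryE /= ai.
rewrite (eq_bigr (fun _ => 1 - x i)); last by move=> q _; rewrite !entryE.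
rewrite [leRHS](eq_bigr (fun q =>
   (clash i)%:R / (agree i)%:R * (1 - w (e (i, q))))); last first.
  by move=> q _; rewrite !entryE.
rewrite sumr_const -clashE // -[leLHS]mulr_natl -mulr_sumr -mulrA.
apply: ler_wpM2l => //.
have ai0 : 0 < (agree i)%:R :> R by rewrite ltr0n ag0.
rewrite -ler_pdivrMl ?invr_gt0 // invrK agreeE // mulr_natl -sumr_const.
apply: ler_sum => q /andP[bq gq].
by have := wx (e (i, q)); rewrite !entryE /= ai bq gq => /(_ isT); lra.
Qed.

(** Trades the count of flowers for a multiple of [agree], so that the load can be
    compared with the sums occurring in gamma. *)
Lemma load_le (beta : I -> R) (tau : R) (q : Q) :
  (forall i, 0 <= beta i) -> (forall i, (0 < agree i)%N) -> 0 < tau ->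
  (forall i, ~~ a i -> tau * (agree i)%:R <= (flowers i)%:R) ->
  load beta q <=
    1 / tau * \sum_(i | ~~ a i && ~~ G (e (i, q))) beta i / (agree i)%:R.
Proof.
move=> beta0 ag0 tau0 fl; rewrite mulr_sumr; apply: ler_sum => i /andP[ai _].
have ai0 : 0 < (agree i)%:R :> R by rewrite ltr0n.
have -> : 1 / tau * (beta i / (agree i)%:R) = beta i * (tau * (agree i)%:R)^-1.
  by field; rewrite !gt_eqF.
apply: ler_wpM2l => //; rewrite lef_pV2 ?fl // posrE ?mulr_gt0 //.
by apply: lt_le_trans (fl i ai); rewrite mulr_gt0.
Qed.

(** For [i] outside [a], a single flower inequality centered at [i] already gives
    [x i <= 0 + (1 - 1)]; for [i] in [a], a core entry of the slice forces
    [1 <= x i]. *)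
Lemma axis_pinned :
  (forall t, core t -> w t <= x (c t).1) ->
  (forall q, b q -> (0 < hits q)%N) -> (forall i, (0 < agree i)%N) ->
  (forall i, 0 <= x i <= 1) ->
  (forall t, petal t -> w t = 0) ->
  (forall t, core t -> w t = 1) ->
  forall i, x i = (a i)%:R.
Proof.
move=> wx h0 ag0 x01 w0 w1 i; apply/eqP; rewrite eq_le.
have /andP[x0 x1] := x01 i.
have /card_gt0P[q] := ag0 i; rewrite inE => /andP[bq].
case: (boolP (a i)) => ai /eqP Giq.
  rewrite x1 /= -(w1 (e (i, q))); last by rewrite !entryE /= ai bq Giq.
  by have := wx (e (i, q)); rewrite !entryE /= ai bq Giq; apply.
rewrite x0 andbT.
have /card_gt0P[i'] := h0 q bq; rewrite inE => /andP[ai' gi'].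
have /= := flower (negbT Giq) gi'.
rewrite w1 ?w0; [lra| |]; by rewrite !entryE /= ?ai ?bq ?Giq ?ai' ?gi'.
Qed.

End Axis.

(** The weights 1/3, 1/2, 1 are the inverses of the number of vanishing
    coordinates of an entry whose first coordinate vanishes. *)
Lemma weighted_count_as_shares (R : realFieldType) (J K : finType)
    (u : pred J) (v : pred K) (P : pred (J * K)) :
  let N (r s : bool) := #|[set q | [&& u q.1 == r, v q.2 == s & P q]]| in
  1 / 3 * (N false false)%:R + 1 / 2 * ((N false true)%:R + (N true false)%:R)
    + (N true true)%:R
  = \sum_(q | P q) (1 + ~~ u q.1 + ~~ v q.2)%:R^-1 :> R.
Proof.
move=> N.
have NE r s : (N r s)%:R = \sum_(q | P q) ((u q.1 == r) && (v q.2 == s))%:R :> R.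
  rewrite -natr_sum; congr (_%:R); rewrite /N -sum1_card big_mkcond [RHS]big_mkcond /=.
  by apply: eq_bigr => q _; rewrite inE; case: (P q); case: eqP; case: eqP.
rewrite !NE -big_split !mulr_sumr -!big_split /=; apply: eq_bigr => q _.
by case: (u _); case: (v _); rewrite /= ?(addn0, addn1, add1n); lra.
Qed.

(** * The three directions together *)

Lemma sum_nat_mean_gt0 (R : realFieldType) (n m : nat) (F : 'I_n -> 'I_m -> nat) i j :
  (0 < F i j)%N -> 0 < (n * m)%:R^-1 * \sum_i \sum_j (F i j)%:R :> R.
Proof.
move=> Fij; apply: mulr_gt0.
  rewrite invr_gt0 ltr0n muln_gt0.
  by rewrite (leq_ltn_trans _ (ltn_ord i)) // (leq_ltn_trans _ (ltn_ord j)).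
under eq_bigr do rewrite -natr_sum.
by rewrite -natr_sum ltr0n (bigD1 i) //= (bigD1 j) //= -addnA ltn_addr.
Qed.

Section Box.
Variables (n m l : nat).

Definition x_coords (t : index n m l) := (t.1.1, (t.1.2, t.2)).
Definition x_index (p : 'I_n * ('I_m * 'I_l)) : index n m l := (p.1, p.2.1, p.2.2).
Definition y_coords (t : index n m l) := (t.1.2, (t.1.1, t.2)).
Definition y_index (p : 'I_m * ('I_n * 'I_l)) : index n m l := (p.2.1, p.1, p.2.2).
Definition z_coords (t : index n m l) := (t.2, (t.1.1, t.1.2)).
Definition z_index (p : 'I_l * ('I_n * 'I_m)) : index n m l := (p.2.1, p.2.2, p.1).

Lemma x_coordsK : cancel x_coords x_index. Proof. by case=> [[]]. Qed.
Lemma x_indexK : cancel x_index x_coords. Proof. by case=> [? []]. Qed.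
Lemma y_coordsK : cancel y_coords y_index. Proof. by case=> [[]]. Qed.
Lemma y_indexK : cancel y_index y_coords. Proof. by case=> [? []]. Qed.
Lemma z_coordsK : cancel z_coords z_index. Proof. by case=> [[]]. Qed.
Lemma z_indexK : cancel z_index z_coords. Proof. by case=> [? []]. Qed.

Variables (xb : vec bool n) (yb : vec bool m) (zb : vec bool l).
Variable G : tensor bool n m l.

Definition supp (t : index n m l) : bool := [&& xb t.1.1, yb t.1.2 & zb t.2].
Definition yz_supp (q : 'I_m * 'I_l) : bool := yb q.1 && zb q.2.
Definition xz_supp (q : 'I_n * 'I_l) : bool := xb q.1 && zb q.2.
Definition xy_supp (q : 'I_n * 'I_m) : bool := xb q.1 && yb q.2.

Lemma TsetE i j k :
  ((i, j, k) \in Tset xb yb zb G) = (G (i, j, k) == [&& xb i, yb j & zb k]).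
Proof. by rewrite inE. Qed.

Lemma Tx_agree i : Tx xb yb zb G true true i = agree x_index xb yz_supp G i.
Proof.
apply: eq_card => q; rewrite !inE /= /yz_supp /x_index /=.
by case: (yb _); case: (zb _); case: (xb _).
Qed.

Lemma Ty_agree j : Ty xb yb zb G true true j = agree y_index yb xz_supp G j.
Proof.
apply: eq_card => q; rewrite !inE /= /xz_supp /y_index /=.
by case: (yb _); case: (zb _); case: (xb _).
Qed.

Lemma Tz_agree k : Tz xb yb zb G true true k = agree z_index zb xy_supp G k.
Proof.
apply: eq_card => q; rewrite !inE /= /xy_supp /z_index /=.
by case: (yb _); case: (zb _); case: (xb _).
Qed.

Lemma Fx_clash i : Fx xb yb zb G true true i = clash x_index xb yz_supp G i.
Proof.
apply: eq_card => q; rewrite !inE /= /yz_supp /x_index /=.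
by case: (yb _); case: (zb _); case: (xb _); case: (G _).
Qed.

Lemma Fy_clash j : Fy xb yb zb G true true j = clash y_index yb xz_supp G j.
Proof.
apply: eq_card => q; rewrite !inE /= /xz_supp /y_index /=.
by case: (yb _); case: (zb _); case: (xb _); case: (G _).
Qed.

Lemma Fz_clash k : Fz xb yb zb G true true k = clash z_index zb xy_supp G k.
Proof.
apply: eq_card => q; rewrite !inE /= /xy_supp /z_index /=.
by case: (yb _); case: (zb _); case: (xb _); case: (G _).
Qed.

Lemma T1yz_hits q : yz_supp q -> T1yz xb yb zb G q.1 q.2 = hits x_index xb G q.
Proof.
case/andP=> yq zq; apply: eq_card => i; rewrite !inE /= yq zq /x_index /=.
by case: (xb _); case: (G _).
Qed.

Lemma T1xz_hits q : xz_supp q -> T1xz xb yb zb G q.1 q.2 = hits y_index yb G q.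
Proof.
case/andP=> xq zq; apply: eq_card => j; rewrite !inE /= xq zq /y_index /=.
by case: (yb _); case: (G _).
Qed.

Lemma T1xy_hits q : xy_supp q -> T1xy xb yb zb G q.1 q.2 = hits z_index zb G q.
Proof.
case/andP=> xq yq; apply: eq_card => k; rewrite !inE /= xq yq /z_index /=.
by case: (zb _); case: (G _).
Qed.

Lemma card_fibers (Q I : finType) (P : pred Q) (r : Q -> pred I) :
  #|[set p : Q * I | P p.1 && r p.1 p.2]| = (\sum_(q | P q) #|[set i | r q i]|)%N.
Proof.
rewrite -sum1_card; under [RHS]eq_bigr do rewrite -sum1_card.
by rewrite pair_big_dep /=; apply: eq_bigl => -[q i]; rewrite !inE.
Qed.

Lemma T111x_flowers i : ~~ xb i -> T111x xb yb zb G i = flowers x_index xb yz_supp G i.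
Proof.
move=> xi; rewrite /flowers -card_fibers; apply: eq_card => -[[j k] i'].
rewrite !inE /= /yz_supp /x_index /= (negPf xi) /=.
by case: (yb j); case: (zb k); case: (xb i'); case: (G (i, j, k)); case: (G _).
Qed.

Lemma T111y_flowers j : ~~ yb j -> T111y xb yb zb G j = flowers y_index yb xz_supp G j.
Proof.
move=> yj; rewrite /flowers -card_fibers; apply: eq_card => -[[i k] j'].
rewrite !inE /= /xz_supp /y_index /= (negPf yj) /=.
by case: (xb i); case: (zb k); case: (yb j'); case: (G (i, j, k)); case: (G _).
Qed.

Lemma T111z_flowers k : ~~ zb k -> T111z xb yb zb G k = flowers z_index zb xy_supp G k.
Proof.
move=> zk; rewrite /flowers -card_fibers; apply: eq_card => -[[i j] k'].
rewrite !inE /= /xy_supp /z_index /= (negPf zk) /=.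
by case: (xb i); case: (yb j); case: (zb k'); case: (G (i, j, k)); case: (G _).
Qed.

Variable R : realFieldType.

Lemma Bx_share i : ~~ xb i -> Bx xb yb zb G R i =
  \sum_(q | G (x_index (i, q))) (1 + ~~ yb q.1 + ~~ zb q.2)%:R^-1.
Proof.
move=> xi; rewrite -weighted_count_as_shares /Bx.
do ![congr (_ + _)|congr (_ * _)|congr (_%:R)];
apply: eq_card => q; rewrite !inE /= (negPf xi) /x_index /=;
by case: (yb _); case: (zb _); case: (G _).
Qed.

Lemma By_share j : ~~ yb j -> By xb yb zb G R j =
  \sum_(q | G (y_index (j, q))) (1 + ~~ xb q.1 + ~~ zb q.2)%:R^-1.
Proof.
move=> yj; rewrite -weighted_count_as_shares /By.
do ![congr (_ + _)|congr (_ * _)|congr (_%:R)];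
apply: eq_card => q; rewrite !inE /= (negPf yj) /y_index /= andbF;
by case: (xb _); case: (zb _); case: (G _).
Qed.

Lemma Bz_share k : ~~ zb k -> Bz xb yb zb G R k =
  \sum_(q | G (z_index (k, q))) (1 + ~~ xb q.1 + ~~ yb q.2)%:R^-1.
Proof.
move=> zk; rewrite -weighted_count_as_shares /Bz.
do ![congr (_ + _)|congr (_ * _)|congr (_%:R)];
apply: eq_card => q; rewrite !inE /= (negPf zk) /z_index /= !andbF;
by case: (xb _); case: (yb _); case: (G _).
Qed.

Lemma Bx_ge0 i : 0 <= Bx xb yb zb G R i.
Proof. by rewrite /Bx !addr_ge0 ?mulr_ge0 ?addr_ge0 ?invr_ge0 ?ler0n ?ler01. Qed.
Lemma By_ge0 i : 0 <= By xb yb zb G R i.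
Proof. by rewrite /By !addr_ge0 ?mulr_ge0 ?addr_ge0 ?invr_ge0 ?ler0n ?ler01. Qed.
Lemma Bz_ge0 i : 0 <= Bz xb yb zb G R i.
Proof. by rewrite /Bz !addr_ge0 ?mulr_ge0 ?addr_ge0 ?invr_ge0 ?ler0n ?ler01. Qed.

Variables (x : vec R n) (y : vec R m) (z : vec R l) (w : tensor R n m l).

Lemma objective_excess :
  flp_objective G (x, y, z, w)
  - flp_objective G (realv R xb, realv R yb, realv R zb,
     outer (realv R xb) (realv R yb) (realv R zb))
  = \sum_(t | ~~ supp t && ~~ G t) w t + \sum_(t | supp t && G t) (1 - w t)
    - \sum_(t | supp t && ~~ G t) (1 - w t) - \sum_(t | ~~ supp t && G t) w t.
Proof.
rewrite /flp_objective opprD addrACA -!sumrB.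
rewrite -!sumrN !(big_mkcond (fun t => t \in _)) !(big_mkcond (fun t => _ && _)).
rewrite -!big_split /=; apply: eq_bigr => t _.
rewrite !inE !ffunE /supp.
by case: (xb _); case: (yb _); case: (zb _); case: (G t) => /=; lra.
Qed.

Hypothesis feas : flp_feasible G (x, y, z, w).

Lemma w_ge0 t : ~~ G t -> 0 <= w t.
Proof.
move=> gt; have [_ h _ _] := feas; case: t gt => [[i j] k] gt.
by case: (h i j k); rewrite // inE.
Qed.

Lemma w_le_xyz t : G t -> [/\ w t <= x t.1.1, w t <= y t.1.2 & w t <= z t.2].
Proof.
move=> gt; have [h _ _ _] := feas; case: t gt => [[i j] k] gt.
by apply: h; rewrite inE.
Qed.

Lemma w_le1 t : G t -> w t <= 1.
Proof.
move=> /w_le_xyz[wx _ _]; apply: le_trans wx _.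
by have [_ _ _ [h _ _]] := feas; case/andP: (h t.1.1).
Qed.

(** Where G is wrongly 1, [w] is at most the mean of those of the three bounds
    x_i, y_j, z_k that vanish at the target. *)
Lemma false_ones_bound :
  \sum_(t | ~~ supp t && G t) w t <=
    \sum_(i | ~~ xb i) Bx xb yb zb G R i * x i
  + \sum_(j | ~~ yb j) By xb yb zb G R j * y j
  + \sum_(k | ~~ zb k) Bz xb yb zb G R k * z k.
Proof.
have -> : \sum_(i | ~~ xb i) Bx xb yb zb G R i * x i =
  \sum_(t | G t && ~~ xb t.1.1) (1 + ~~ yb t.1.2 + ~~ zb t.2)%:R^-1 * x t.1.1.
  rewrite (sum_axis x_coordsK x_indexK) big_mkcond; apply: eq_bigr => i _ /=.
  case: ifP => xi.
    by rewrite Bx_share // mulr_suml; apply: eq_bigl => q; rewrite andbT.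
  by rewrite big_pred0 // => q; rewrite andbF.
have -> : \sum_(j | ~~ yb j) By xb yb zb G R j * y j =
  \sum_(t | G t && ~~ yb t.1.2) (1 + ~~ xb t.1.1 + ~~ zb t.2)%:R^-1 * y t.1.2.
  rewrite (sum_axis y_coordsK y_indexK) big_mkcond; apply: eq_bigr => j _ /=.
  case: ifP => yj.
    by rewrite By_share // mulr_suml; apply: eq_bigl => q; rewrite andbT.
  by rewrite big_pred0 // => q; rewrite andbF.
have -> : \sum_(k | ~~ zb k) Bz xb yb zb G R k * z k =
  \sum_(t | G t && ~~ zb t.2) (1 + ~~ xb t.1.1 + ~~ yb t.1.2)%:R^-1 * z t.2.
  rewrite (sum_axis z_coordsK z_indexK) big_mkcond; apply: eq_bigr => k _ /=.
  case: ifP => zk.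
    by rewrite Bz_share // mulr_suml; apply: eq_bigl => q; rewrite andbT.
  by rewrite big_pred0 // => q; rewrite andbF.
rewrite !(big_mkcond (fun t => _ && _)) -!big_split; apply: ler_sum => t _ /=.
rewrite /supp; case: (boolP (G t)) => gt; last by rewrite andbF /= !addr0.
have [wx wy wz] := w_le_xyz gt.
by case: (xb _); case: (yb _); case: (zb _); rewrite /= ?(addn0, addn1, add1n); lra.
Qed.

(** The petals of the three directions are disjoint. *)
Lemma petals_bound :
  \sum_(t | petal x_coords xb yz_supp G t) w t
  + \sum_(t | petal y_coords yb xz_supp G t) w t
  + \sum_(t | petal z_coords zb xy_supp G t) w t
  <= \sum_(t | ~~ supp t && ~~ G t) w t.
Proof.
rewrite !(big_mkcond (fun t => petal _ _ _ _ t)) (big_mkcond (fun t => _ && _)).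
rewrite -!big_split; apply: ler_sum => t _ /=.
rewrite /petal /supp /yz_supp /xz_supp /xy_supp /=.
case: (boolP (G t)) => gt; first by rewrite !andbF /= !addr0.
have := w_ge0 gt.
by case: (xb _); case: (yb _); case: (zb _); rewrite /=; lra.
Qed.

Lemma flower_x i i' q : ~~ G (x_index (i, q)) -> G (x_index (i', q)) ->
  w (x_index (i', q)) - w (x_index (i, q)) <= 1 - x i.
Proof. by have [_ _ [h _ _] _] := feas => g g'; apply: h; rewrite inE. Qed.

Lemma flower_y j j' q : ~~ G (y_index (j, q)) -> G (y_index (j', q)) ->
  w (y_index (j', q)) - w (y_index (j, q)) <= 1 - y j.
Proof. by have [_ _ [_ h _] _] := feas => g g'; apply: h; rewrite inE. Qed.

Lemma flower_z k k' q : ~~ G (z_index (k, q)) -> G (z_index (k', q)) ->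
  w (z_index (k', q)) - w (z_index (k, q)) <= 1 - z k.
Proof. by have [_ _ [_ _ h] _] := feas => g g'; apply: h; rewrite inE. Qed.

Lemma core_x t : core x_coords xb yz_supp G t = supp t && G t.
Proof.
rewrite /core /supp /yz_supp /=.
by case: (xb _); case: (yb _); case: (zb _).
Qed.

Lemma core_y t : core y_coords yb xz_supp G t = supp t && G t.
Proof.
rewrite /core /supp /xz_supp /=.
by case: (xb _); case: (yb _); case: (zb _).
Qed.

Lemma core_z t : core z_coords zb xy_supp G t = supp t && G t.
Proof.
rewrite /core /supp /xy_supp /=.
by case: (xb _); case: (yb _); case: (zb _).
Qed.

Lemma hole_x t : hole x_coords xb yz_supp G t = supp t && ~~ G t.
Proof.
rewrite /hole /supp /yz_supp /=.
by case: (xb _); case: (yb _); case: (zb _).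
Qed.

Lemma hole_y t : hole y_coords yb xz_supp G t = supp t && ~~ G t.
Proof.
rewrite /hole /supp /xz_supp /=.
by case: (xb _); case: (yb _); case: (zb _).
Qed.

Lemma hole_z t : hole z_coords zb xy_supp G t = supp t && ~~ G t.
Proof.
rewrite /hole /supp /xy_supp /=.
by case: (xb _); case: (yb _); case: (zb _).
Qed.

Hypotheses
  (hitsx : forall q, yz_supp q -> (0 < hits x_index xb G q)%N)
  (hitsy : forall q, xz_supp q -> (0 < hits y_index yb G q)%N)
  (hitsz : forall q, xy_supp q -> (0 < hits z_index zb G q)%N)
  (agreex : forall i, (0 < agree x_index xb yz_supp G i)%N)
  (agreey : forall j, (0 < agree y_index yb xz_supp G j)%N)
  (agreez : forall k, (0 < agree z_index zb xy_supp G k)%N)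
  (flowersx : forall i, ~~ xb i -> (0 < flowers x_index xb yz_supp G i)%N)
  (flowersy : forall j, ~~ yb j -> (0 < flowers y_index yb xz_supp G j)%N)
  (flowersz : forall k, ~~ zb k -> (0 < flowers z_index zb xy_supp G k)%N).

Let beta_x := Bx xb yb zb G R.
Let beta_y := By xb yb zb G R.
Let beta_z := Bz xb yb zb G R.

Definition petal_slack_x t := petal_slack x_coords x_index xb yz_supp G beta_x t.
Definition petal_slack_y t := petal_slack y_coords y_index yb xz_supp G beta_y t.
Definition petal_slack_z t := petal_slack z_coords z_index zb xy_supp G beta_z t.

Definition core_slack (t : index n m l) : R :=
  1 - (load x_index xb yz_supp G beta_x (x_coords t).2
       + load y_index yb xz_supp G beta_y (y_coords t).2
       + load z_index zb xy_supp G beta_z (z_coords t).2)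
    - 1 / 3 * (charge R x_coords x_index xb yz_supp G t
               + charge R y_coords y_index yb xz_supp G t
               + charge R z_coords z_index zb xy_supp G t).

(** The weak duality computation: [zero_bound] is used with full weight in each
    direction, and [one_bound] with weight 1/3, since each of the three bounds
    covers all the holes. *)
Lemma objective_gap :
  \sum_(t | petal x_coords xb yz_supp G t) petal_slack_x t * w t
  + \sum_(t | petal y_coords yb xz_supp G t) petal_slack_y t * w t
  + \sum_(t | petal z_coords zb xy_supp G t) petal_slack_z t * w t
  + \sum_(t | supp t && G t) core_slack t * (1 - w t)
  <= flp_objective G (x, y, z, w)
  - flp_objective G (realv R xb, realv R yb, realv R zb,
     outer (realv R xb) (realv R yb) (realv R zb)).
Proof.
rewrite objective_excess.
have zx := zero_bound x_coordsK x_indexK flower_x Bx_ge0 flowersx.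
have zy := zero_bound y_coordsK y_indexK flower_y By_ge0 flowersy.
have zz := zero_bound z_coordsK z_indexK flower_z Bz_ge0 flowersz.
have wx t : core x_coords xb yz_supp G t -> w t <= x (x_coords t).1.
  by move=> /and3P[_ _ /w_le_xyz[]].
have wy t : core y_coords yb xz_supp G t -> w t <= y (y_coords t).1.
  by move=> /and3P[_ _ /w_le_xyz[]].
have wz t : core z_coords zb xy_supp G t -> w t <= z (z_coords t).1.
  by move=> /and3P[_ _ /w_le_xyz[]].
have ox := one_bound x_coordsK x_indexK flower_x wx hitsx (fun i _ => agreex i).
have oy := one_bound y_coordsK y_indexK flower_y wy hitsy (fun i _ => agreey i).
have oz := one_bound z_coordsK z_indexK flower_z wz hitsz (fun i _ => agreez i).
rewrite (eq_bigl _ _ core_x) in zx; rewrite (eq_bigl _ _ core_y) in zy.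
rewrite (eq_bigl _ _ core_z) in zz.
rewrite (eq_bigl _ _ hole_x) (eq_bigl _ _ core_x) in ox.
rewrite (eq_bigl _ _ hole_y) (eq_bigl _ _ core_y) in oy.
rewrite (eq_bigl _ _ hole_z) (eq_bigl _ _ core_z) in oz.
have -> : \sum_(t | supp t && G t) core_slack t * (1 - w t) =
  \sum_(t | supp t && G t) (1 - w t)
  - (\sum_(t | supp t && G t) load x_index xb yz_supp G beta_x (x_coords t).2 * (1 - w t)
     + \sum_(t | supp t && G t) load y_index yb xz_supp G beta_y (y_coords t).2 * (1 - w t)
     + \sum_(t | supp t && G t) load z_index zb xy_supp G beta_z (z_coords t).2 * (1 - w t))
  - 1 / 3 * (\sum_(t | supp t && G t) charge R x_coords x_index xb yz_supp G t * (1 - w t)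
     + \sum_(t | supp t && G t) charge R y_coords y_index yb xz_supp G t * (1 - w t)
     + \sum_(t | supp t && G t) charge R z_coords z_index zb xy_supp G t * (1 - w t)).
  rewrite -!big_split mulr_sumr -!sumrB; apply: eq_bigr => t _ /=.
  by rewrite /core_slack; ring.
have slackE (P : pred (index n m l)) (f : index n m l -> R) :
    \sum_(t | P t) (1 - f t) * w t = \sum_(t | P t) w t - \sum_(t | P t) f t * w t.
  by rewrite -sumrB; apply: eq_bigr => t _; rewrite mulrBl mul1r.
rewrite !slackE.
have := false_ones_bound; have := petals_bound.
rewrite -/beta_x -/beta_y -/beta_z in zx zy zz *; lra.
Qed.

End Box.

(** * Optimality and uniqueness *)

Lemma psum_wt_eq0 (R : realFieldType) (S : finType) (P : pred S) (k f : S -> R) :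
  (forall t, P t -> 0 < k t) -> (forall t, P t -> 0 <= f t) ->
  \sum_(t | P t) k t * f t <= 0 -> forall t, P t -> f t = 0.
Proof.
move=> k0 f0 s0 t Pt.
have kf0 u : P u -> 0 <= k u * f u by move=> Pu; rewrite mulr_ge0 ?f0 // ltW ?k0.
have s_eq0 : \sum_(t | P t) k t * f t = 0.
  by apply/eqP; rewrite eq_le s0 sumr_ge0.
have /eqP := @psumr_eq0P _ _ _ _ kf0 s_eq0 t Pt.
by rewrite mulf_eq0 gt_eqF ?k0 //= => /eqP.
Qed.

Section Optimality.
Variables (R : realFieldType) (n m l : nat).
Variables (xb : vec bool n) (yb : vec bool m) (zb : vec bool l).
Variable G : tensor bool n m l.

Let bar : flp_point R n m l :=
  (realv R xb, realv R yb, realv R zb, outer (realv R xb) (realv R yb) (realv R zb)).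

Lemma outer_supp t :
  outer (realv R xb) (realv R yb) (realv R zb) t = (supp xb yb zb t)%:R :> R.
Proof.
rewrite !ffunE /supp.
by case: (xb _); case: (yb _); case: (zb _); rewrite /= ?(mulr1, mulr0, mul0r).
Qed.

Lemma bar_feasible : flp_feasible G bar.
Proof.
split; last first.
- by split=> i; rewrite ffunE ler0n lern1 leq_b1.
- split=> i j k i' _ _; rewrite !outer_supp /supp /= !ffunE.
  + by case: (xb i); case: (xb i'); case: (yb j); case: (zb k) => /=; lra.
  + by case: (xb i); case: (yb i'); case: (yb j); case: (zb k) => /=; lra.
  + by case: (xb i); case: (zb i'); case: (yb j); case: (zb k) => /=; lra.
- move=> i j k _; rewrite !outer_supp /supp /= !ffunE.
  by case: (xb i); case: (yb j); case: (zb k) => /=; lra.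
move=> i j k _; rewrite !outer_supp /supp /= !ffunE.
by case: (xb i); case: (yb j); case: (zb k); split=> /=; lra.
Qed.

(** With x, y, z at the target, the constraints bound [w] by the target from the
    side on which the objective pushes it, entry by entry. *)
Lemma tensor_pinned (w : tensor R n m l) :
  flp_feasible G (realv R xb, realv R yb, realv R zb, w) ->
  flp_objective G (realv R xb, realv R yb, realv R zb, w) <= flp_objective G bar ->
  w = outer (realv R xb) (realv R yb) (realv R zb).
Proof.
move=> feas; rewrite -subr_le0 objective_excess => le0.
pose f t := (if G t then -1 else 1) * (w t - (supp xb yb zb t)%:R).
have f0 t : true -> 0 <= f t.
  move=> _; rewrite /f; case: ifP => gt.
    have [] := w_le_xyz feas gt; rewrite /supp !ffunE.
    by case: (xb _); case: (yb _); case: (zb _) => /=; lra.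
  have := w_ge0 feas (negbT gt); have [_ h _ _] := feas.
  case: t gt => [[i j] k] gt; have [] := h i j k; first by rewrite inE gt.
  by rewrite /supp !ffunE /=; case: (xb _); case: (yb _); case: (zb _) => /=; lra.
apply/ffunP=> t; rewrite outer_supp.
have sf : \sum_t 1 * f t <= 0.
  apply: le_trans le0; rewrite -!sumrN !(big_mkcond (fun t => _ && _)).
  rewrite -!big_split; apply: ler_sum => u _ /=; rewrite /f.
  by case: (supp _ _ _ _); case: (G u) => /=; lra.
have := psum_wt_eq0 (fun _ _ => ltr01) f0 sf (t := t) isT.
by rewrite /f; case: (G t); lra.
Qed.

(** Strict complementarity: since all the coefficients of the gap are positive, a
    point as good as the target has no slack on the petals and on the core. *)
Lemma flower_unique_optimal :
  (forall q, yz_supp yb zb q -> (0 < hits (@x_index n m l) xb G q)%N) ->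
  (forall q, xz_supp xb zb q -> (0 < hits (@y_index n m l) yb G q)%N) ->
  (forall q, xy_supp xb yb q -> (0 < hits (@z_index n m l) zb G q)%N) ->
  (forall i, (0 < agree (@x_index n m l) xb (yz_supp yb zb) G i)%N) ->
  (forall j, (0 < agree (@y_index n m l) yb (xz_supp xb zb) G j)%N) ->
  (forall k, (0 < agree (@z_index n m l) zb (xy_supp xb yb) G k)%N) ->
  (forall i, ~~ xb i -> (0 < flowers (@x_index n m l) xb (yz_supp yb zb) G i)%N) ->
  (forall j, ~~ yb j -> (0 < flowers (@y_index n m l) yb (xz_supp xb zb) G j)%N) ->
  (forall k, ~~ zb k -> (0 < flowers (@z_index n m l) zb (xy_supp xb yb) G k)%N) ->
  (forall t, petal (@x_coords n m l) xb (yz_supp yb zb) G t ->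
     0 < petal_slack_x xb yb zb G R t) ->
  (forall t, petal (@y_coords n m l) yb (xz_supp xb zb) G t ->
     0 < petal_slack_y xb yb zb G R t) ->
  (forall t, petal (@z_coords n m l) zb (xy_supp xb yb) G t ->
     0 < petal_slack_z xb yb zb G R t) ->
  (forall t, supp xb yb zb t && G t -> 0 < core_slack xb yb zb G R t) ->
  flp_unique_optimal G bar.
Proof.
move=> hx hy hz agx agy agz flx fly flz px py pz cs.
have gap (x : vec R n) (y : vec R m) (z : vec R l)
    (w : tensor R n m l) (feas : flp_feasible G (x, y, z, w)) :=
  objective_gap feas hx hy hz agx agy agz flx fly flz.
have nonneg (x : vec R n) (y : vec R m) (z : vec R l)
    (w : tensor R n m l) (feas : flp_feasible G (x, y, z, w)) :
  [/\ forall t, petal (@x_coords n m l) xb (yz_supp yb zb) G t -> 0 <= w t,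
      forall t, petal (@y_coords n m l) yb (xz_supp xb zb) G t -> 0 <= w t,
      forall t, petal (@z_coords n m l) zb (xy_supp xb yb) G t -> 0 <= w t
    & forall t, supp xb yb zb t && G t -> 0 <= 1 - w t].
  split=> t; try by case/and3P=> _ _; apply: w_ge0 feas _.
  by case/andP=> _ gt; rewrite subr_ge0 (w_le1 feas).
have sums (x : vec R n) (y : vec R m) (z : vec R l)
    (w : tensor R n m l) (feas : flp_feasible G (x, y, z, w)) :
  [/\ 0 <= \sum_(t | petal (@x_coords n m l) xb (yz_supp yb zb) G t)
         petal_slack_x xb yb zb G R t * w t,
      0 <= \sum_(t | petal (@y_coords n m l) yb (xz_supp xb zb) G t)
         petal_slack_y xb yb zb G R t * w t,
      0 <= \sum_(t | petal (@z_coords n m l) zb (xy_supp xb yb) G t)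
         petal_slack_z xb yb zb G R t * w t
    & 0 <= \sum_(t | supp xb yb zb t && G t) core_slack xb yb zb G R t * (1 - w t)].
  have [? ? ? ?] := nonneg _ _ _ _ feas.
  by split; apply: sumr_ge0 => t Pt; apply: mulr_ge0; auto; apply: ltW; auto.
have opt : flp_optimal G bar.
  split; first exact: bar_feasible.
  move=> [[[x y] z] w] feas; have := gap _ _ _ _ feas.
  by have [] := sums _ _ _ _ feas; rewrite -/bar; lra.
split=> // -[[[x y] z] w] [feas min].
have [nx ny nz nc] := nonneg _ _ _ _ feas.
have [sx sy sz sc] := sums _ _ _ _ feas.
have g := gap _ _ _ _ feas; have le := min _ bar_feasible; rewrite -/bar in g.
have /(_ ltac:(lra)) w0x := psum_wt_eq0 px nx.
have /(_ ltac:(lra)) w0y := psum_wt_eq0 py ny.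
have /(_ ltac:(lra)) w0z := psum_wt_eq0 pz nz.
have w1 t : supp xb yb zb t && G t -> w t = 1.
  by move=> Pt; have /(_ ltac:(lra) t Pt) := psum_wt_eq0 cs nc; lra.
have [_ _ _ [x01 y01 z01]] := feas.
have xE : x = realv R xb.
  apply/ffunP=> i; rewrite ffunE.
  apply: (axis_pinned (@x_indexK n m l) (flower_x feas) _ hx agx x01 w0x).
    by move=> t /and3P[_ _ /(w_le_xyz feas)[]].
  by move=> t; rewrite core_x; apply: w1.
have yE : y = realv R yb.
  apply/ffunP=> i; rewrite ffunE.
  apply: (axis_pinned (@y_indexK n m l) (flower_y feas) _ hy agy y01 w0y).
    by move=> t /and3P[_ _ /(w_le_xyz feas)[]].
  by move=> t; rewrite core_y; apply: w1.
have zE : z = realv R zb.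
  apply/ffunP=> i; rewrite ffunE.
  apply: (axis_pinned (@z_indexK n m l) (flower_z feas) _ hz agz z01 w0z).
    by move=> t /and3P[_ _ /(w_le_xyz feas)[]].
  by move=> t; rewrite core_z; apply: w1.
subst x y z; rewrite /bar; congr (_, _).
exact: tensor_pinned.
Qed.

End Optimality.

(** * From the counting conditions to the multipliers *)

(** The slice of an index outside its support has, by positivity of T_11, an entry
    in both other supports; an index inside two of them is completed by T_1. *)
Lemma ones_exist n m l (xb : vec bool n) (yb : vec bool m) (zb : vec bool l)
    (G : tensor bool n m l) :
  Fset xb yb zb G != set0 ->
  (forall i, ~~ xb i -> (0 < Tx xb yb zb G true true i)%N) ->
  (forall j, ~~ yb j -> (0 < Ty xb yb zb G true true j)%N) ->
  (forall i j, xb i -> yb j -> (1 <= T1xy xb yb zb G i j)%N) ->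
  (forall j k, yb j -> zb k -> (1 <= T1yz xb yb zb G j k)%N) ->
  (forall i k, xb i -> zb k -> (1 <= T1xz xb yb zb G i k)%N) ->
  exists i j k, [&& xb i, yb j & zb k].
Proof.
move=> /set0Pn[[[i0 j0] k0] _] Tx0 Ty0 Hxy Hyz Hxz.
case: (boolP (xb i0)) => xi; last first.
  have /card_gt0P[[j k]] := Tx0 _ xi; rewrite inE /= => /and3P[/eqP yj /eqP zk _].
  have /card_gt0P[i] := Hyz j k yj zk; rewrite inE => /andP[xi' _].
  by exists i, j, k; rewrite xi' yj zk.
case: (boolP (yb j0)) => yj; last first.
  have /card_gt0P[[i k]] := Ty0 _ yj; rewrite inE /= => /and3P[/eqP xi' /eqP zk _].
  have /card_gt0P[j] := Hxz i k xi' zk; rewrite inE => /andP[yj' _].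
  by exists i, j, k; rewrite xi' yj' zk.
have /card_gt0P[k] := Hxy i0 j0 xi yj; rewrite inE => /andP[zk _].
by exists i0, j0, k; rewrite xi yj zk.
Qed.

(** How condition (3) enters, with [T] for T_11, [f] for T_111, [h] for T_1. *)
Lemma petal_slack_gt0 (R : realFieldType) (B T f h : R) :
  0 < f -> 0 < h -> B < Num.min T (f / h) -> 0 < 1 - B * h / f.
Proof.
move=> f0 h0; rewrite lt_min => /andP[_ lt].
by rewrite subr_gt0 ltr_pdivrMr // mul1r -ltr_pdivlMr.
Qed.

Theorem proposition11 (R : realFieldType) (n m l : nat)
    (xb : vec bool n) (yb : vec bool m) (zb : vec bool l)
    (G : tensor bool n m l) (alpha : R)
    (HF : Fset xb yb zb G != set0)
    (Halpha : 0 < alpha < 1)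
    (* not in (0)-(4): without it (3) is void at an index with T_11 = 0, and the
       conclusion fails there *)
    (Hpos_x : forall i, ~~ xb i -> (0 < Tx xb yb zb G true true i)%N)
    (Hpos_y : forall j, ~~ yb j -> (0 < Ty xb yb zb G true true j)%N)
    (Hpos_z : forall k, ~~ zb k -> (0 < Tz xb yb zb G true true k)%N)
    (H0_x : forall i, ~~ xb i -> (0 < Fxtot xb yb zb G i)%N)
    (H0_y : forall j, ~~ yb j -> (0 < Fytot xb yb zb G j)%N)
    (H0_z : forall k, ~~ zb k -> (0 < Fztot xb yb zb G k)%N)
    (H1_xy : forall i j, xb i -> yb j -> (1 <= T1xy xb yb zb G i j)%N)
    (H1_yz : forall j k, yb j -> zb k -> (1 <= T1yz xb yb zb G j k)%N)
    (H1_xz : forall i k, xb i -> zb k -> (1 <= T1xz xb yb zb G i k)%N)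
    (H2_x : forall i, ~~ xb i ->
       (T111x xb yb zb G i)%:R
         >= alpha * (Tx xb yb zb G true true i)%:R * Tbaryz xb yb zb G R)
    (H2_y : forall j, ~~ yb j ->
       (T111y xb yb zb G j)%:R
         >= alpha * (Ty xb yb zb G true true j)%:R * Tbarxz xb yb zb G R)
    (H2_z : forall k, ~~ zb k ->
       (T111z xb yb zb G k)%:R
         >= alpha * (Tz xb yb zb G true true k)%:R * Tbarxy xb yb zb G R)
    (H3_x : forall i j k, (i, j, k) \in Tset xb yb zb G ->
       ~~ xb i -> yb j -> zb k ->
       Num.min (Tx xb yb zb G true true i)%:R
         ((T111x xb yb zb G i)%:R / (T1yz xb yb zb G j k)%:R)
         > Bx xb yb zb G R i)
    (H3_y : forall i j k, (i, j, k) \in Tset xb yb zb G ->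
       ~~ yb j -> xb i -> zb k ->
       Num.min (Ty xb yb zb G true true j)%:R
         ((T111y xb yb zb G j)%:R / (T1xz xb yb zb G i k)%:R)
         > By xb yb zb G R j)
    (H3_z : forall i j k, (i, j, k) \in Tset xb yb zb G ->
       ~~ zb k -> xb i -> yb j ->
       Num.min (Tz xb yb zb G true true k)%:R
         ((T111z xb yb zb G k)%:R / (T1xy xb yb zb G i j)%:R)
         > Bz xb yb zb G R k)
    (H4 : forall i j k, (i, j, k) \in Tset xb yb zb G :&: Pset xb yb zb ->
       3 * gamma xb yb zb G alpha i j k >
         Num.max ((Fx xb yb zb G true true i)%:R / (Tx xb yb zb G true true i)%:R)
           (Num.max
             ((Fy xb yb zb G true true j)%:R / (Ty xb yb zb G true true j)%:R)
             ((Fz xb yb zb G true true k)%:R / (Tz xb yb zb G true true k)%:R))) :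
  flp_unique_optimal G
    (realv R xb, realv R yb, realv R zb,
     outer (realv R xb) (realv R yb) (realv R zb)).
Proof.
have [i1 [j1 [k1 /and3P[xi1 yj1 zk1]]]] :=
  ones_exist HF Hpos_x Hpos_y H1_xy H1_yz H1_xz.
have a0 : 0 < alpha by case/andP: Halpha.
have tx : 0 < alpha * Tbaryz xb yb zb G R.
  by apply: mulr_gt0 => //; apply: (sum_nat_mean_gt0 _ (H1_yz j1 k1 yj1 zk1)).
have ty : 0 < alpha * Tbarxz xb yb zb G R.
  by apply: mulr_gt0 => //; apply: (sum_nat_mean_gt0 _ (H1_xz i1 k1 xi1 zk1)).
have tz : 0 < alpha * Tbarxy xb yb zb G R.
  by apply: mulr_gt0 => //; apply: (sum_nat_mean_gt0 _ (H1_xy i1 j1 xi1 yj1)).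
have hx q : yz_supp yb zb q -> (0 < hits (@x_index n m l) xb G q)%N.
  by move=> bq; rewrite -(T1yz_hits _ G bq) //; case/andP: bq; apply: H1_yz.
have hy q : xz_supp xb zb q -> (0 < hits (@y_index n m l) yb G q)%N.
  by move=> bq; rewrite -(T1xz_hits _ G bq) //; case/andP: bq; apply: H1_xz.
have hz q : xy_supp xb yb q -> (0 < hits (@z_index n m l) zb G q)%N.
  by move=> bq; rewrite -(T1xy_hits _ G bq) //; case/andP: bq; apply: H1_xy.
have agx i : (0 < agree (@x_index n m l) xb (yz_supp yb zb) G i)%N.
  case: (boolP (xb i)) => xi; last by rewrite -Tx_agree Hpos_x.
  have /card_gt0P[k] := H1_xy i j1 xi yj1; rewrite inE TsetE xi yj1 => /andP[zk /eqP g].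
  by apply/card_gt0P; exists (j1, k); rewrite inE /yz_supp /x_index /= g xi yj1 zk.
have agy j : (0 < agree (@y_index n m l) yb (xz_supp xb zb) G j)%N.
  case: (boolP (yb j)) => yj; last by rewrite -Ty_agree Hpos_y.
  have /card_gt0P[k] := H1_xy i1 j xi1 yj; rewrite inE TsetE xi1 yj => /andP[zk /eqP g].
  by apply/card_gt0P; exists (i1, k); rewrite inE /xz_supp /y_index /= g xi1 yj zk.
have agz k : (0 < agree (@z_index n m l) zb (xy_supp xb yb) G k)%N.
  case: (boolP (zb k)) => zk; last by rewrite -Tz_agree Hpos_z.
  have /card_gt0P[j] := H1_xz i1 k xi1 zk; rewrite inE TsetE xi1 zk => /andP[yj /eqP g].
  by apply/card_gt0P; exists (i1, j); rewrite inE /xy_supp /z_index /= g xi1 yj zk.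
have flx i : ~~ xb i -> alpha * Tbaryz xb yb zb G R
    * (agree (@x_index n m l) xb (yz_supp yb zb) G i)%:R
    <= (flowers (@x_index n m l) xb (yz_supp yb zb) G i)%:R.
  by move=> xi; rewrite -T111x_flowers // -Tx_agree mulrAC H2_x.
have fly j : ~~ yb j -> alpha * Tbarxz xb yb zb G R
    * (agree (@y_index n m l) yb (xz_supp xb zb) G j)%:R
    <= (flowers (@y_index n m l) yb (xz_supp xb zb) G j)%:R.
  by move=> yj; rewrite -T111y_flowers // -Ty_agree mulrAC H2_y.
have flz k : ~~ zb k -> alpha * Tbarxy xb yb zb G R
    * (agree (@z_index n m l) zb (xy_supp xb yb) G k)%:R
    <= (flowers (@z_index n m l) zb (xy_supp xb yb) G k)%:R.
  by move=> zk; rewrite -T111z_flowers // -Tz_agree mulrAC H2_z.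
have flx0 i : ~~ xb i -> (0 < flowers (@x_index n m l) xb (yz_supp yb zb) G i)%N.
  by move=> xi; rewrite -(ltr0n R); apply: lt_le_trans (flx i xi); rewrite mulr_gt0 ?ltr0n.
have fly0 j : ~~ yb j -> (0 < flowers (@y_index n m l) yb (xz_supp xb zb) G j)%N.
  by move=> yj; rewrite -(ltr0n R); apply: lt_le_trans (fly j yj); rewrite mulr_gt0 ?ltr0n.
have flz0 k : ~~ zb k -> (0 < flowers (@z_index n m l) zb (xy_supp xb yb) G k)%N.
  by move=> zk; rewrite -(ltr0n R); apply: lt_le_trans (flz k zk); rewrite mulr_gt0 ?ltr0n.
apply: flower_unique_optimal => //.
- move=> [[i j] k] /and3P[/= xi bq /negPf g]; have /andP[/= yj zk] := bq.
  apply: (@petal_slack_gt0 R _ (Tx xb yb zb G true true i)%:R) => /=.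
  + by rewrite ltr0n flx0.
  + by rewrite ltr0n hx.
  rewrite -T111x_flowers // -(T1yz_hits _ G bq) //=; apply: H3_x => //.
  by rewrite TsetE g (negPf xi).
- move=> [[i j] k] /and3P[/= yj bq /negPf g]; have /andP[/= xi zk] := bq.
  apply: (@petal_slack_gt0 R _ (Ty xb yb zb G true true j)%:R) => /=.
  + by rewrite ltr0n fly0.
  + by rewrite ltr0n hy.
  rewrite -T111y_flowers // -(T1xz_hits _ G bq) //=; apply: H3_y => //.
  by rewrite TsetE g (negPf yj) andbF.
- move=> [[i j] k] /and3P[/= zk bq /negPf g]; have /andP[/= xi yj] := bq.
  apply: (@petal_slack_gt0 R _ (Tz xb yb zb G true true k)%:R) => /=.
  + by rewrite ltr0n flz0.
  + by rewrite ltr0n hz.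
  rewrite -T111z_flowers // -(T1xy_hits _ G bq) //=; apply: H3_z => //.
  by rewrite TsetE g (negPf zk) !andbF.
move=> [[i j] k] /andP[/and3P[/= xi yj zk] g].
have := H4 i j k; rewrite !inE /= xi yj zk g => /(_ isT).
rewrite !gt_max /gamma.
have lx := load_le (j, k) (@Bx_ge0 _ _ _ xb yb zb G R) agx tx flx.
have ly := load_le (i, k) (@By_ge0 _ _ _ xb yb zb G R) agy ty fly.
have lz := load_le (i, j) (@Bz_ge0 _ _ _ xb yb zb G R) agz tz flz.
have -> : \sum_(i' | ~~ xb i' && ((i', j, k) \in Tset xb yb zb G))
     Bx xb yb zb G R i' / (Tx xb yb zb G true true i')%:R =
  \sum_(i' | ~~ xb i' && ~~ G (x_index (i', (j, k))))
     Bx xb yb zb G R i' / (agree (@x_index n m l) xb (yz_supp yb zb) G i')%:R.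
  apply: eq_big => [i'|i' _]; last by rewrite Tx_agree.
  by rewrite TsetE /x_index /=; case: (xb i'); case: (G _).
have -> : \sum_(j' | ~~ yb j' && ((i, j', k) \in Tset xb yb zb G))
     By xb yb zb G R j' / (Ty xb yb zb G true true j')%:R =
  \sum_(j' | ~~ yb j' && ~~ G (y_index (j', (i, k))))
     By xb yb zb G R j' / (agree (@y_index n m l) yb (xz_supp xb zb) G j')%:R.
  apply: eq_big => [j'|j' _]; last by rewrite Ty_agree.
  by rewrite TsetE /y_index /= xi; case: (yb j'); case: (G _).
have -> : \sum_(k' | ~~ zb k' && ((i, j, k') \in Tset xb yb zb G))
     Bz xb yb zb G R k' / (Tz xb yb zb G true true k')%:R =
  \sum_(k' | ~~ zb k' && ~~ G (z_index (k', (i, j))))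
     Bz xb yb zb G R k' / (agree (@z_index n m l) zb (xy_supp xb yb) G k')%:R.
  apply: eq_big => [k'|k' _]; last by rewrite Tz_agree.
  by rewrite TsetE /z_index /= xi yj; case: (zb k'); case: (G _).
(* The three ratios are bounded by their maximum, so each third of 3 gamma
   covers one of them. *)
rewrite /core_slack /charge /=.
have bx : yz_supp yb zb (j, k) by rewrite /yz_supp /= yj.
have by_ : xz_supp xb zb (i, k) by rewrite /xz_supp /= xi.
have bz : xy_supp xb yb (i, j) by rewrite /xy_supp /= xi.
rewrite (T1yz_hits _ G bx) (T1xz_hits _ G by_) (T1xy_hits _ G bz).
rewrite !Tx_agree !Ty_agree !Tz_agree !Fx_clash !Fy_clash !Fz_clash.
have onesE p (u : vec bool p) : ones u = #|(u : pred 'I_p)|.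
  by apply: eq_card => s; rewrite inE.
rewrite !onesE => /and3P[].
lra.
Qed.
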